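(* Let $A$ be an $n\times n$ complex matrix with distinct eigenvalues $\lambda_1,\dots,\lambda_s$ ordered so that $|\lambda_1|\geq |\lambda_2|\geq\cdots\geq|\lambda_s|$, let $\|\cdot\|$ be any norm on $\mathbb{C}^n$, and let $1\leq t<s$. Let $W_t$ be a complex matrix with $n$ rows whose columns span the Jordan space of $A$ relative to the eigenvalues $\lambda_1,\dots,\lambda_t$. Then $$|\lambda_{t+1}| = \lim_{k\to\infty}\phi_{\|\cdot\|}(W_t,A^k)^{1/k}.$$
   Context: For $A\in\mathbb{C}^{n\times n}$, a norm $\|\cdot\|$ on $\mathbb{C}^n$ and $W\in\mathbb{C}^{n\times p}$, define $$\phi_{\|\cdot\|}(W,A)=\max\{\|x^*A\| : x\in\mathbb{C}^n,\ \|x\|\leq 1,\ W^*x=0\}.$$ Here $^*$ denotes conjugate transpose, and the norm of a row vector $z^*$ is the norm of the column vector $z$, i.e. $\|x^*A\|$ means $\|A^*x\|$. The Jordan space (Jordan subspace) of $A$ relative to the distinct eigenvalues $\lambda_1,\dots,\lambda_t$ is the sum of the corresponding (right) generalized eigenspaces, $\bigoplus_{i=1}^t\ker (A-\lambda_i I)^n$. *)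

(* Defs.v *)
From HB Require Import structures.
From mathcomp Require Import all_boot all_order all_algebra.
From mathcomp Require Import sesquilinear spectral complex.
From mathcomp Require Import boolp classical_sets functions reals topology.
From mathcomp Require Import normedtype sequences exp.

Set Implicit Arguments.
Unset Strict Implicit.
Unset Printing Implicit Defensive.

Import Order.TTheory GRing.Theory Num.Theory.
Import numFieldNormedType.Exports.

Local Open Scope classical_set_scope.
Local Open Scope sesquilinear_scope.
Local Open Scope complex_scope.
Local Open Scope ring_scope.

(* The modulus of a complex number as an element of R; the library's `|z| lies
   in R[i]. *)
Notation cmod := ComplexField.Normc.normc.

Record is_norm (R : realType) (n : nat) (N : 'cV[R[i]]_n -> R) : Prop := IsNorm {
  is_norm_ge0 : forall x, 0 <= N x;
  is_norm_eq0 : forall x, N x = 0 -> x = 0;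
  is_normZ : forall (c : R[i]) x, N (c *: x) = cmod c * N x;
  is_normD : forall x y, N (x + y) <= N x + N y
}.

(* The maximum of a set of reals, 0 if the set has no maximum. *)
Definition set_max (R : realType) (S : set R) : R := xget 0 (S `&` ubound S).

(* The norm of the row vector x^* A is by convention that of its conjugate
   transpose A^* x. *)
Definition phi (R : realType) (n p : nat) (N : 'cV[R[i]]_n -> R)
    (W : 'M[R[i]]_(n, p)) (A : 'M[R[i]]_n) : R :=
  set_max [set N (A ^t* *m x) | x in [set x : 'cV[R[i]]_n | N x <= 1 /\ W ^t* *m x = 0]].

(* The Jordan space of A relative to lam i for i < t. As geigenspace B a is the
   left kernel of (B - a I)^n, the transposes of the x with (A - a I)^n x = 0
   form the row space of geigenspace A^T a. *)
Definition jordan_space (R : realType) (n s : nat) (A : 'M[R[i]]_n)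
    (lam : 'I_s -> R[i]) (t : nat) : 'M[R[i]]_n :=
  (\sum_(i < s | (i < t)%N) geigenspace A^T (lam i))%MS.

(* Main.v *)
(* With z := x^*, the number phi (W, A^k) is the norm of z |-> z A^k on the row
   vectors z with z W = 0, which form an A-stable space.  A left eigenvector for
   lam_(t+1) is orthogonal to the Jordan space, so phi (W, A^k) >=
   |lam_(t+1)|^k.  Conversely, by Cayley-Hamilton each such z is killed by
   prod_(i > t) (A - lam_i)^n, and peeling off one factor at a time bounds
   |z A^k| by a multiple of (|lam_(t+1)| + e)^k |z|, for every e > 0.  Taking
   k-th roots squeezes the limit. *)

Require Import Defs.
From mathcomp Require Import all_boot all_order all_algebra.
From mathcomp Require Import sesquilinear spectral complex.
From mathcomp Require Import boolp classical_sets functions reals topology.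
From mathcomp Require Import normedtype sequences exp derive.
From mathcomp Require Import ring.
Import Order.TTheory GRing.Theory Num.Theory.
Import numFieldNormedType.Exports.
Local Open Scope classical_set_scope.
Local Open Scope complex_scope.
Local Open Scope ring_scope.

Set Implicit Arguments.
Unset Strict Implicit.
Unset Printing Implicit Defensive.

(** * Polynomials in [A] and the left annihilator of its Jordan space *)

Lemma horner_mx_tr (F : fieldType) (n : nat) (A : 'M[F]_n.+1) (p : {poly F}) :
  horner_mx A^T p = (horner_mx A p)^T.
Proof.
elim/poly_ind: p => [|p c IHp]; first by rewrite !rmorph0 trmx0.
rewrite !rmorphD !rmorphM /= !horner_mx_X !horner_mx_C linearD /= tr_scalar_mx.
rewrite IHp -mulmxE -trmx_mul; congr (_^T + _).
by rewrite mulmxE; apply/esym/comm_horner_mx.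
Qed.

Section JordanSpace.
Variables (F : closedFieldType) (n s : nat) (A : 'M[F]_n.+1) (lam : 'I_s -> F).
Hypothesis lam_inj : injective lam.
Hypothesis lam_eig : forall a, eigenvalue A a -> exists i, lam i = a.

Let q i : {poly F} := ('X - (lam i)%:P) ^+ n.+1.

(** The characteristic polynomial splits into [n.+1] linear factors, and each of them divides
    [\prod_i ('X - (lam i)%:P)] because [lam] lists all eigenvalues. Matching one factor with one
    copy of this product avoids multiplicities. *)
Lemma char_poly_dvd_prod : char_poly A %| \prod_i q i.
Proof.
have [r Dr] := closed_field_poly_normal (char_poly A).
have := size_char_poly A; rewrite {1}Dr (monicP (char_poly_monic A)) scale1r.
rewrite size_prod_XsubC => -[sz_r].
rewrite Dr (monicP (char_poly_monic A)) scale1r prodrXl -sz_r.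
have : {in r, forall z, exists i, lam i = z}.
  move=> z zr; apply: lam_eig; rewrite eigenvalue_root_char Dr.
  by rewrite (monicP (char_poly_monic A)) scale1r root_prod_XsubC.
elim: {sz_r Dr}r => [_|z r IHr rP]; first by rewrite big_nil dvd1p.
rewrite big_cons exprS dvdp_mul ?IHr//; last first.
  by move=> y yr; apply: rP; rewrite inE yr orbT.
have [i <-] := rP z (mem_head _ _).
by rewrite (bigD1 i)//= dvdp_mulr.
Qed.

Lemma horner_mx_prod_eq0 : horner_mx A (\prod_i q i) = 0.
Proof.
have /dvdpP[p ->] := char_poly_dvd_prod.
by rewrite rmorphM /= Cayley_Hamilton mulr0.
Qed.

(** As the [q i] are pairwise coprime, the sum of the generalized eigenspaces is the kernel of the
    product of the [q i] with [P i]. Multiplying by the remaining factors gives the full product,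
    which vanishes at [A^T]. *)
Lemma sub_sum_geigenspace (P : {pred 'I_s}) :
  (horner_mx A^T (\prod_(i | ~~ P i) q i) <=
   \sum_(i | P i) geigenspace A^T (lam i))%MS.
Proof.
rewrite -(kermxpoly_prod (A^T) (p_ := q)); last first.
  move=> i j _ _ ji; rewrite coprimep_expl// coprimep_expr// coprimep_XsubC.
  by rewrite root_XsubC inj_eq.
apply/sub_kermxP; rewrite mulmxE -rmorphM /= mulrC.
have -> : \prod_(i | P i) q i * \prod_(i | ~~ P i) q i = \prod_i q i.
  by rewrite [RHS](bigID P).
by rewrite horner_mx_tr horner_mx_prod_eq0 trmx0.
Qed.

(** By the previous inclusion the matrix [horner_mx A (\prod_(i | ~~ P i) q i)] factors as
    [W *m D^T]. *)
Lemma annihilator_jordan (p : nat) (P : {pred 'I_s}) (W : 'M[F]_(n.+1, p))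
    (z : 'rV[F]_n.+1) :
  (\sum_(i | P i) geigenspace A^T (lam i) <= W^T)%MS -> z *m W = 0 ->
  z *m horner_mx A (\prod_(i | ~~ P i) q i) = 0.
Proof.
move=> /(submx_trans (sub_sum_geigenspace P))/submxP[D].
rewrite horner_mx_tr => /(congr1 trmx); rewrite trmxK trmx_mul trmxK => ->.
by rewrite mulmxA => ->; rewrite mul0mx.
Qed.

End JordanSpace.

(** On [v^T] the power [(A^T - lam i)^k] acts as the nonzero scalar [(a - lam i)^k], while the
    generalized eigenspace for [lam i] is killed by that power. *)
Lemma eigenvector_annihilates_jordan (F : fieldType) (n s p : nat)
    (A : 'M[F]_n.+1) (lam : 'I_s -> F) (P : {pred 'I_s}) (W : 'M[F]_(n.+1, p))
    (v : 'rV[F]_n.+1) (a : F) :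
  (W^T <= \sum_(i | P i) geigenspace A^T (lam i))%MS ->
  (forall i, P i -> lam i != a) -> v *m A = a *: v -> v *m W = 0.
Proof.
move=> WP aP vA; suff /sub_kermxP/(congr1 trmx) : (W^T <= kermx v^T)%MS.
  by rewrite trmx_mul !trmxK trmx0.
apply: submx_trans WP _; apply/sumsmx_subP => i Pi.
rewrite geigenspaceE; apply/sub_kermxP; set k := n.+1; set g := kermx _.
have vX m : (A^T - (lam i)%:M) ^+ m *m v^T = (a - lam i) ^+ m *: v^T.
  elim: m => [|m IHm]; first by rewrite !expr0 mul1mx scale1r.
  rewrite exprSr -mulmxA mulmxBl -trmx_mul vA mul_scalar_mx linearZ /= -scalerBl.
  by rewrite -scalemxAr IHm scalerA -exprS.
have : g *m ((A^T - (lam i)%:M) ^+ k *m v^T) = 0 by rewrite mulmxA mulmx_ker mul0mx.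
rewrite vX -scalemxAr => /eqP; rewrite scaler_eq0 expf_eq0 /= subr_eq0.
by rewrite eq_sym (negPf (aP i Pi)) => /eqP.
Qed.

(** * Squeezing k-th roots between exponential bounds *)

Lemma powR_inv_cvg (R : realType) (u : R^nat) (rho : R) : 0 <= rho ->
  (forall k, rho ^+ k <= u k) ->
  (forall e, 0 < e -> exists K, forall k, u k <= K * (rho + e) ^+ k) ->
  (fun k => u k `^ (k%:R)^-1) @ \oo --> rho.
Proof.
move=> rho0 u_ge u_le.
have powRX (x : R) k : (0 < k)%N -> 0 <= x -> (x ^+ k) `^ k%:R^-1 = x.
  move=> k0 x0; rewrite -powR_mulrn// -powRrM divff ?powRr1//.
  by rewrite pnatr_eq0 -lt0n.
have u0 k : 0 <= u k by apply: le_trans (u_ge k); rewrite exprn_ge0.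
apply/cvgrPdist_le => e e0.
(* Using only half of [e] leaves a geometric factor [x ^+ k], with [x < 1], that eventually absorbs
   the constant [K]. *)
have [K uK] := u_le (e / 2) (divr_gt0 e0 (ltr0Sn R 1)).
pose x := (rho + e / 2) / (rho + e).
have re0 : 0 < rho + e by rewrite ltr_wpDl.
have re20 : 0 < rho + e / 2 by rewrite ltr_wpDl// divr_gt0.
have x1 : `|x| < 1.
  rewrite ger0_norm ?divr_ge0 ?ltW// ltr_pdivrMr// mul1r ltrD2l.
  by rewrite ltr_pdivrMr// mulr_natr mulr2n ltrDl.
have /cvgrPdist_le/(_ 1 ltr01) : (fun k => K * x ^+ k) @ \oo --> (0 : R).
  by rewrite -[X in _ --> X](mulr0 K); apply: cvgMr; exact: cvg_expr.
move=> Kx; near=> k.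
(* At [k = 0] the exponent is [0^-1 = 0], so the root carries no information there. *)
have k0 : (0 < k)%N by near: k; exists 1%N.
have ue : u k <= (rho + e) ^+ k.
  apply: le_trans (uK k) _.
  have -> : K * (rho + e / 2) ^+ k = (K * x ^+ k) * (rho + e) ^+ k.
    rewrite /x expr_div_n -!mulrA mulVf ?mulr1// expf_neq0// gt_eqF//.
  rewrite ler_piMl ?exprn_ge0 ?(ltW re0)//.
  have : `|0 - K * x ^+ k| <= 1 by near: k.
  by rewrite sub0r normrN => /ler_normlP[].
have lo : rho <= u k `^ k%:R^-1.
  rewrite -[leLHS](powRX _ k)//.
  by apply: ge0_ler_powR; rewrite ?nnegrE ?exprn_ge0 ?invr_ge0.
have hi : u k `^ k%:R^-1 <= rho + e.
  rewrite -[leRHS](powRX _ k) ?(ltW re0)//.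
  by apply: ge0_ler_powR; rewrite ?nnegrE ?exprn_ge0 ?invr_ge0 ?(ltW re0).
by rewrite distrC ger0_norm ?subr_ge0// lerBlDl.
Unshelve. all: by end_near.
Qed.

(** * Seminorms on complex row vectors, and compactness *)

Section Seminorm.
Variable (R : realType).
Implicit Types (V : lmodType R[i]).

(** Besides the norm itself, this covers maps with a kernel, such as the norm of [z *m A] or a size
    of [z *m W]. *)
Record is_seminorm V (q : V -> R) : Prop := IsSeminorm {
  seminormZ : forall c x, q (c *: x) = cmod c * q x;
  seminormD : forall x y, q (x + y) <= q x + q y
}.

Lemma cmod_real (a : R) : cmod a%:C = `|a|.
Proof. by rewrite /= expr0n addr0 sqrtr_sqr. Qed.

Lemma cmodJ (z : R[i]) : cmod (Num.conj z) = cmod z.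
Proof. by apply: complexI; exact: (norm_conjC z). Qed.

Lemma cmod_ge0 (z : R[i]) : 0 <= cmod z.
Proof. by case: z => a b; exact: sqrtr_ge0. Qed.

(* R[i]^n as a real space, where compactness of bounded closed sets is
   available. *)
Definition cvec n (x : 'rV[R]_(n + n)) : 'rV[R[i]]_n :=
  \row_j (x 0 (lshift n j) +i* x 0 (rshift n j)).

Lemma cvecD n (x y : 'rV[R]_(n + n)) : cvec (x + y) = cvec x + cvec y.
Proof. by apply/rowP => j; rewrite !mxE. Qed.

Lemma cvecZ n (a : R) (x : 'rV[R]_(n + n)) : cvec (a *: x) = a%:C *: cvec x.
Proof. by apply/rowP => j; rewrite !mxE; simpc. Qed.

Lemma cvec_surj n (z : 'rV[R[i]]_n) : exists x, z = cvec x.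
Proof.
exists (row_mx (\row_j complex.Re (z 0 j)) (\row_j complex.Im (z 0 j))).
by apply/rowP => j; rewrite mxE row_mxEl row_mxEr !mxE; case: (z 0 j).
Qed.

Section Bounded.
Variables (m : nat) (q : 'rV[R]_m -> R).
Hypothesis qZ : forall a x, q (a *: x) = `|a| * q x.
Hypothesis qD : forall x y, q (x + y) <= q x + q y.

Let q0 : q 0 = 0. Proof. by rewrite -(scale0r 0) qZ normr0 mul0r. Qed.

Let qN x : q (- x) = q x. Proof. by rewrite -scaleN1r qZ normrN1 mul1r. Qed.

Lemma real_seminorm_ge0 x : 0 <= q x.
Proof.
have := qD x (- x); rewrite subrr q0 qN -mulr2n.
by rewrite pmulrn_lge0.
Qed.

Lemma real_seminorm_bounded : exists2 K, 0 <= K & forall x, q x <= K * `|x|.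
Proof.
exists (\sum_j q (delta_mx 0 j)) => [|x].
  by apply: sumr_ge0 => j _; exact: real_seminorm_ge0.
rewrite {1}[x]row_sum_delta mulr_suml.
have : q (\sum_j x 0 j *: delta_mx 0 j) <= \sum_j q (x 0 j *: delta_mx 0 j).
  elim/big_ind2: _ => [||j _]; rewrite ?q0//.
  by move=> a b c d ab cd; apply: le_trans (qD _ _) (lerD ab cd).
move=> /le_trans -> //; apply: ler_sum => j _; rewrite qZ mulrC.
apply: ler_wpM2l; first exact: real_seminorm_ge0.
(* The library norm of a matrix is the largest modulus of its entries. *)
rewrite [leRHS](mx_normrE x).
exact: (le_bigmax _ (fun ij => `|x ij.1 ij.2|) (0, j)).
Qed.

(** The reverse triangle inequality and boundedness make [q] Lipschitz. *)
Lemma real_seminorm_continuous : continuous q.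
Proof.
have [K K0 qK] := real_seminorm_bounded.
have qB x y : `|q x - q y| <= K * `|x - y|.
  rewrite ler_norml; apply/andP; split.
    rewrite lerNl opprB lerBlDl distrC; apply: le_trans (lerD (lexx _) (qK _)).
    by rewrite -{1}[y](subrKC x); exact: qD.
  rewrite lerBlDl; apply: le_trans (lerD (lexx _) (qK _)).
  by rewrite -{1}[x](subrKC y); exact: qD.
move=> x; apply/(@cvgrPdist_lt _ _ _ (nbhs x)) => e e0; apply/nbhs_ballP.
(* [K + 1] rather than [K], since [K] may be 0. *)
exists (e / (K + 1)) => [/=|y]; first by rewrite divr_gt0// ltr_wpDl.
rewrite -ball_normE /ball_ /= => xy; apply: le_lt_trans (qB x y) _.
move: xy; rewrite ltr_pdivlMr ?ltr_wpDl// => /le_lt_trans; apply.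
by rewrite mulrC ler_wpM2l// lerDl.
Qed.

End Bounded.

Section ComplexSeminorm.
Variable (n : nat).
Implicit Types (q N : 'rV[R[i]]_n -> R).

Lemma seminorm_ge0 V (q : V -> R) x : is_seminorm q -> 0 <= q x.
Proof.
move=> [qZ qD]; have := qD x (- x).
rewrite subrr -(scale0r x) qZ Normc.normc0 mul0r -scaleN1r qZ normcN Normc.normc1 mul1r.
by rewrite -mulr2n pmulrn_lge0.
Qed.

Lemma seminorm_cvec_bounded q : is_seminorm q ->
  exists2 K, 0 <= K & forall x, q (cvec x) <= K * `|x|.
Proof.
move=> [qZ qD]; apply: real_seminorm_bounded => [a x|x y].
- by rewrite cvecZ qZ cmod_real.
- by rewrite cvecD.
Qed.

Lemma seminorm_cvec_continuous q : is_seminorm q -> continuous (q \o @cvec n).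
Proof.
move=> [qZ qD]; apply: real_seminorm_continuous => [a x|x y] /=.
- by rewrite cvecZ qZ cmod_real.
- by rewrite cvecD.
Qed.

Variable (N : 'rV[R[i]]_n -> R).
Hypothesis (N_semi : is_seminorm N) (N_eq0 : forall z, N z = 0 -> z = 0).

(** The minimum of [N] on the compact unit sphere of the sup norm is positive because [N] is
    definite; homogeneity carries the bound to all vectors. *)
Lemma norm_cvec_ge : exists2 c, 0 < c & forall x, c * `|x| <= N (cvec x).
Proof.
pose S : set 'rV[R]_(n + n) := [set x | `|x| = 1].
have S_compact : compact S.
  apply: bounded_closed_compact.
    by exists 1; split; [exact: num_real|move=> M M1 x /= ->; exact: ltW].
  have -> : S = Num.norm @^-1` [set 1] by [].
  apply: preimage_closed => [x _|]; first exact: norm_continuous.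
  exact: closed_eq.
have scaled x : x != 0 -> S (`|x|^-1 *: x).
  move=> x0; rewrite /S /= normrZ ger0_norm ?invr_ge0//.
  by rewrite mulVf// normr_eq0.
(* An empty sphere means that 0 is the only vector, and any [c] will do. *)
have [[x0 Sx0]|S0] := pselect (S !=set0); last first.
  exists 1 => // x; suff -> : x = 0 by rewrite normr0 mulr0 seminorm_ge0.
  by apply: contrapT => /eqP/scaled Sx; apply: S0; exists (`|x|^-1 *: x).
have NS : {within S, continuous (N \o @cvec n)}.
  by apply: continuous_subspaceT; exact: seminorm_cvec_continuous.
have [y /set_mem Sy yP] := compact_EVT_min (ex_intro _ x0 Sx0) S_compact NS.
exists (N (cvec y)).
  rewrite lt_neqAle seminorm_ge0// andbT eq_sym; apply/eqP => /N_eq0 y0.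
  have : y = 0.
    apply/rowP => j; rewrite mxE; case: (split_ordP j) => k ->.
      by move/rowP/(_ k): y0; rewrite !mxE => -[].
    by move/rowP/(_ k): y0; rewrite !mxE => -[].
  by move=> y00; move: Sy; rewrite /S /= y00 normr0 => /eqP; rewrite eq_sym oner_eq0.
move=> x; have [->|x_neq0] := eqVneq x 0.
  by rewrite normr0 mulr0 seminorm_ge0.
have := yP _ (mem_set (scaled x x_neq0)).
rewrite /= cvecZ (seminormZ N_semi) cmod_real ger0_norm ?invr_ge0//.
by rewrite mulrC ler_pdivlMr ?normr_gt0.
Qed.

Lemma seminorm_bounded q : is_seminorm q ->
  exists2 K, 0 <= K & forall z, q z <= K * N z.
Proof.
move=> /seminorm_cvec_bounded[K K0 qK]; have [c c0 Nc] := norm_cvec_ge.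
exists (K / c) => [|z]; first by rewrite divr_ge0// ltW.
have [x ->] := cvec_surj z; apply: le_trans (qK x) _.
by rewrite -mulrA ler_wpM2l// mulrC ler_pdivlMr// mulrC.
Qed.

(** Writing the linear constraint as the zero set of a seminorm makes the feasible set closed; it is
    bounded by [norm_cvec_ge], so the continuous [q] attains its maximum. *)
Lemma norm_max (q r : 'rV[R[i]]_n -> R) : is_seminorm q -> is_seminorm r ->
  exists z, [/\ N z <= 1, r z = 0 &
    forall y, N y <= 1 -> r y = 0 -> q y <= q z].
Proof.
move=> q_semi r_semi.
pose B : set 'rV[R]_(n + n) := [set x | N (cvec x) <= 1 /\ r (cvec x) = 0].
have B0 : B 0.
  by rewrite /B /= -(scale0r 0) cvecZ !seminormZ// cmod_real normr0 !mul0r.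
have B_compact : compact B.
  apply: bounded_closed_compact.
    have [c c0 Nc] := norm_cvec_ge.
    exists c^-1; split; first exact: num_real.
    move=> M cM x /= [Nx _]; apply: le_trans (ltW cM).
    by rewrite -[leRHS]mul1r ler_pdivlMr// mulrC (le_trans (Nc x)).
  have -> : B = (N \o @cvec n) @^-1` [set y | y <= 1] `&`
                (r \o @cvec n) @^-1` [set 0] by [].
  apply: closedI; apply: preimage_closed.
  - by move=> x _; exact: seminorm_cvec_continuous.
  - exact: closed_le.
  - by move=> x _; exact: seminorm_cvec_continuous.
  - exact: closed_eq.
have qB : {within B, continuous (q \o @cvec n)}.
  by apply: continuous_subspaceT; exact: seminorm_cvec_continuous.
have [x /set_mem[Nx rx] xP] := compact_EVT_max (ex_intro _ 0 B0) B_compact qB.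
exists (cvec x); split=> // y; have [y' ->] := cvec_surj y => Ny ry.
by apply: xP; apply: mem_set.
Qed.

End ComplexSeminorm.

Lemma seminorm_comp (V U : lmodType R[i]) (f : {linear U -> V}) (q : V -> R) :
  is_seminorm q -> is_seminorm (q \o f).
Proof.
by move=> [qZ qD]; split=> [c x|x y] /=; [rewrite linearZ qZ|rewrite linearD].
Qed.

End Seminorm.

(** * Growth of powers on vectors killed by a product of linear factors *)

Section SpectralGrowth.
Variables (R : realType) (n : nat) (N : 'rV[R[i]]_n.+1 -> R).
Hypothesis (N_semi : is_seminorm N) (N_eq0 : forall z, N z = 0 -> z = 0).

(** Induction on the list of roots: if [z] is killed by the factors of [a :: r], then
    [z *m (A - a%:M)] is killed by those of [r]. The constant [K] is uniform in [z] and [k]. *)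
Lemma annihilated_growth (A : 'M[R[i]]_n.+1) (rho e : R) (r : seq R[i]) :
  0 < e -> {in r, forall a, cmod a <= rho} ->
  exists2 K, 0 <= K & forall z k,
    z *m horner_mx A (\prod_(a <- r) ('X - a%:P)) = 0 ->
    N (z *m A ^+ k) <= K * (rho + e) ^+ k * N z.
Proof.
move=> e0; elim: r => [|a r IHr] r_rho.
  (* The empty product is the identity matrix, so [z = 0]. *)
  exists 0 => // z k; rewrite big_nil rmorph1 mulmx1 => ->.
  by rewrite mul0mx -(scale0r 0) seminormZ// Normc.normc0 !mul0r.
have [|K K0 NK] := IHr; first by move=> b br; rewrite r_rho// inE br orbT.
have a_rho : cmod a <= rho by rewrite r_rho// mem_head.
have [B B0 NB] := seminorm_bounded N_semi N_eq0
  (seminorm_comp (mulmxr (A - a%:M)) N_semi).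
have K'0 : 0 <= 1 + K * B / e by rewrite addr_ge0// divr_ge0 ?mulr_ge0// ltW.
(* [K' = 1 + K B / e] satisfies [K B + rho K' <= K' (rho + e)], which closes the
   induction on [k] for [z A^(k+1) = z (A - a) A^k + a z A^k]. *)
exists (1 + K * B / e) => // z k.
rewrite big_cons rmorphM rmorphB /= horner_mx_X horner_mx_C -mulmxE mulmxA.
set y := z *m _ => yr0.
have rho0 : 0 <= rho := le_trans (cmod_ge0 a) a_rho.
have re0 : 0 <= rho + e by rewrite addr_ge0// ltW.
have Nz0 : 0 <= N z by exact: seminorm_ge0.
elim: k => [|k IHk].
  by rewrite !expr0 mulmx1 mulr1 ler_peMl// lerDl divr_ge0 ?mulr_ge0// ltW.
have -> : z *m A ^+ k.+1 = y *m A ^+ k + a *: (z *m A ^+ k).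
  rewrite exprS -mulmxE mulmxA /y mulmxBr mul_mx_scalar mulmxBl -scalemxAl.
  by rewrite subrK.
apply: le_trans (seminormD N_semi _ _) _; rewrite seminormZ//.
have step1 : N (y *m A ^+ k) <= K * (rho + e) ^+ k * (B * N z).
  apply: le_trans (NK _ _ yr0) _; apply: ler_wpM2l (NB z).
  by rewrite mulr_ge0 ?exprn_ge0.
have step2 : cmod a * N (z *m A ^+ k) <=
    rho * ((1 + K * B / e) * (rho + e) ^+ k * N z).
  by rewrite ler_pM ?cmod_ge0// seminorm_ge0.
apply: le_trans (lerD step1 step2) _.
have -> : (1 + K * B / e) * (rho + e) ^+ k.+1 * N z =
    K * (rho + e) ^+ k * (B * N z) +
    rho * ((1 + K * B / e) * (rho + e) ^+ k * N z) + e * (rho + e) ^+ k * N z.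
  by rewrite exprS; field; rewrite gt_eqF.
by rewrite lerDl !mulr_ge0 ?exprn_ge0// ltW.
Qed.

End SpectralGrowth.

(** * [phi] as an attained maximum over row vectors *)

Section Phi.
Variables (R : realType) (n : nat) (N : 'cV[R[i]]_n -> R).
Hypothesis N_norm : is_norm N.

Definition row_norm (z : 'rV[R[i]]_n) : R := N (z ^t*)%sesqui.

Lemma row_norm_seminorm : is_seminorm row_norm.
Proof.
split=> [c x|x y]; rewrite /row_norm.
  by rewrite linearZ /= map_mxZ (is_normZ N_norm) cmodJ.
by rewrite linearD /= map_mxD (is_normD N_norm).
Qed.

Lemma row_norm_eq0 z : row_norm z = 0 -> z = 0.
Proof.
by move=> /(is_norm_eq0 N_norm) z0; rewrite -[z]trmxCK z0 trmx0 map_mx0.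
Qed.

Lemma set_max_eq (S : set R) x : S x -> ubound S x -> set_max S = x.
Proof.
move=> Sx Sub; rewrite /set_max; case: xgetP => [y _ [Sy Suby]|/(_ x)[]//].
by apply/eqP; rewrite eq_le Sub// Suby.
Qed.

(** The substitution [z = x^*] turns [W^* x = 0] into [z *m W = 0] and [A^* x] into [z *m A]. Since
    the maximum is attained, [set_max] does not fall back on its default. *)
Lemma phi_max (p : nat) (W : 'M[R[i]]_(n, p)) (A : 'M[R[i]]_n) :
  exists z, [/\ row_norm z <= 1, z *m W = 0, phi N W A = row_norm (z *m A) &
    forall y, row_norm y <= 1 -> y *m W = 0 -> row_norm (y *m A) <= phi N W A].
Proof.
(* A seminorm whose zero set is the constraint [z *m W = 0], as [norm_max] requires. *)
pose r (z : 'rV[R[i]]_n) : R := \sum_j cmod ((z *m W) 0 j).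
have r0 z : r z = 0 <-> z *m W = 0.
  split=> [/eqP|zW]; last by rewrite /r zW big1// => j _; rewrite mxE Normc.normc0.
  rewrite psumr_eq0 => [/allP zW|j _]; last exact: cmod_ge0.
  apply/rowP => j; rewrite [RHS]mxE; apply: Normc.eq0_normc; apply/eqP.
  by apply: zW; rewrite mem_index_enum.
have r_semi : is_seminorm r.
  split=> [c x|x y]; rewrite /r.
    rewrite mulr_sumr; apply: eq_bigr => j _.
    by rewrite -scalemxAl mxE Normc.normcM.
  rewrite -big_split /=; apply: ler_sum => j _.
  by rewrite mulmxDl mxE; exact: le_normcD.
have [z [Nz /r0 zW zmax]] := norm_max row_norm_seminorm row_norm_eq0
  (seminorm_comp (mulmxr A) row_norm_seminorm) r_semi.
have tE (x : 'cV[R[i]]_n) : N (A ^t* *m x)%sesqui = row_norm (x ^t* *m A)%sesqui.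
  by rewrite /row_norm trmx_mul map_mxM trmxCK.
have WE (x : 'cV[R[i]]_n) : (W ^t* *m x = 0)%sesqui <-> (x ^t* *m W = 0)%sesqui.
  have WxE : (x ^t* *m W = (W ^t* *m x) ^t*)%sesqui.
    by rewrite trmx_mul map_mxM trmxCK.
  split=> [xW|xW]; first by rewrite WxE xW trmx0 map_mx0.
  by rewrite -[LHS]trmxCK -WxE xW trmx0 map_mx0.
have phiE : phi N W A = row_norm (z *m A).
  apply: set_max_eq.
    exists (z ^t*)%sesqui; last by rewrite tE trmxCK.
    by split=> //; apply/WE; rewrite trmxCK.
  move=> _ [x [Nx /WE xW] <-]; rewrite tE; apply: zmax; last exact/r0.
  by rewrite /row_norm trmxCK.
exists z; split=> // y Ny yW; rewrite phiE.
by apply: zmax => //; apply/r0.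
Qed.

End Phi.

Theorem theorem2p4 (R : realType) (n s t p : nat) (A : 'M[R[i]]_n)
    (lam : 'I_s -> R[i])
    (lam_inj : injective lam)
    (lam_eig : forall a : R[i], eigenvalue A a <-> exists i, lam i = a)
    (lam_sorted : forall i j : 'I_s, (i <= j)%N -> cmod (lam j) <= cmod (lam i))
    (N : 'cV[R[i]]_n -> R) (N_norm : is_norm N)
    (t_ge1 : (1 <= t)%N) (t_lt_s : (t < s)%N)
    (W : 'M[R[i]]_(n, p)) (W_span : (W^T == jordan_space A lam t)%MS) :
  (fun k : nat => phi N W (A ^+ k) `^ (k%:R)^-1) @ \oo
    --> cmod (lam (Ordinal t_lt_s)).
Proof.
case: n A lam_eig N N_norm W W_span => [|n] A lam_eig N N_norm W.
  (* In dimension 0 there is no nonzero eigenvector, contradicting the existence of [lam t]. *)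
  have /eigenvalueP[v _] : eigenvalue A (lam (Ordinal t_lt_s)).
    by apply/lam_eig; exists (Ordinal t_lt_s).
  by rewrite thinmx0 eqxx.
move=> /andP[W_sub sub_W].
set rho := cmod _.
have N_semi := row_norm_seminorm N_norm.
have N_eq0 := row_norm_eq0 N_norm.
apply: powR_inv_cvg; first exact: cmod_ge0.
(* Lower bound: a left eigenvector scaled to norm 1 is feasible. Indices start at 0, so
   [Ordinal t_lt_s] selects the eigenvalue number [t + 1]. *)
- move=> k; have /eigenvalueP[v vA v0] : eigenvalue A (lam (Ordinal t_lt_s)).
    by apply/lam_eig; exists (Ordinal t_lt_s).
  have vW : v *m W = 0.
    apply: eigenvector_annihilates_jordan W_sub _ vA => i it.
    by rewrite inj_eq// -val_eqE /= neq_ltn it.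
  have Nv : row_norm N v != 0 by apply: contra_neq v0; exact: N_eq0.
  have Nv0 : 0 < row_norm N v by rewrite lt_neqAle eq_sym Nv seminorm_ge0.
  have vAk : v *m A ^+ k = lam (Ordinal t_lt_s) ^+ k *: v.
    elim: k => [|k IHk]; first by rewrite !expr0 mulmx1 scale1r.
    by rewrite exprS -mulmxE mulmxA vA -scalemxAl IHk scalerA -exprS.
  pose c : R := (row_norm N v)^-1.
  have c0 : 0 <= c by rewrite invr_ge0 ltW.
  have [_ [_ _ _ phi_ge]] := phi_max N_norm W (A ^+ k).
  have := phi_ge (c%:C *: v).
  rewrite -scalemxAl vW scaler0 -scalemxAl vAk !(seminormZ N_semi) cmod_real.
  rewrite ger0_norm// mulVf// => /(_ (lexx _) erefl); apply: le_trans.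
  rewrite mulrCA mulVf// mulr1 /rho; elim: k {phi_ge vAk} => [|k IHk].
    by rewrite !expr0 Normc.normc1.
  by rewrite !exprS Normc.normcM ler_wpM2l ?cmod_ge0.
- move=> e e0.
  (* Each eigenvalue with index at least [t] is repeated [n.+1] times, which splits the annihilating
     product into linear factors; the ordering of [lam] bounds all of them by [rho]. *)
  pose r := flatten [seq nseq n.+1 (lam i) | i <- enum [pred i : 'I_s | ~~ (i < t)%N]].
  have rE : \prod_(a <- r) ('X - a%:P) =
      \prod_(i < s | ~~ (i < t)%N) ('X - (lam i)%:P) ^+ n.+1.
    rewrite big_flatten big_map big_enum /=; apply: eq_bigr => i _.
    by rewrite -[_ :: _]/(nseq n.+1 (lam i)) big_nseq iter_mulr_1.
  have r_rho : {in r, forall a, cmod a <= rho}.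
    move=> a /flatten_mapP[j]; rewrite mem_enum inE -leqNgt => tj.
    by rewrite mem_nseq => /eqP ->; exact: lam_sorted.
  have [K K0 NK] := annihilated_growth N_semi N_eq0 A e0 r_rho.
  (* Upper bound: the growth estimate is applied to a vector [z] attaining [phi], which depends on
     [k] while [K] does not. *)
  exists K => k; have [z [Nz zW -> _]] := phi_max N_norm W (A ^+ k).
  have rho_e : 0 <= rho + e by rewrite addr_ge0 ?cmod_ge0// ltW.
  apply: le_trans (NK z k _) _.
    rewrite rE; apply: annihilator_jordan (zW) => //.
    by move=> a /lam_eig.
  by rewrite ler_piMr// mulr_ge0 ?exprn_ge0.
Qed.
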